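(* For every $\frac12<\alpha<1$ and every $k\in\mathbb{N}$ there exists $C=C(\alpha,k)>0$ such that every discrete self-expanding ($\mathrm{DSE}$) space $X$ with $\frac{L(X)}{D(X)}>C$ contains a $k$-point subspace $Y\subset X$ which is an $\mathrm{SRA}(\alpha)$ space.
   Context: For $0<\alpha<1$, a metric space $(Y,d)$ is an $\mathrm{SRA}(\alpha)$ space if for all $x,y,z\in Y$, $d(x,y)\le\max\{d(x,z)+\alpha d(z,y),\ \alpha d(x,z)+d(z,y)\}$. A $\mathrm{DSE}$ (discrete self-expanding) space is a finite $n$-point metric space $X=\{x_1,\dots,x_n\}$ with a fixed enumeration of its (distinct) points such that $d(x_i,x_j)\le d(x_i,x_k)$ for all $1\le i\le j\le k\le n$. For such a space, $L(X)=\sum_{i=1}^{n-1}d(x_i,x_{i+1})$ and $D(X)=d(x_1,x_n)$. *)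

(* Defs.v *)
From HB Require Import structures.
From mathcomp Require Import all_boot all_order all_algebra.
From mathcomp Require Import all_classical all_reals.
From mathcomp Require Import topology.

Set Implicit Arguments.
Unset Strict Implicit.
Unset Printing Implicit Defensive.

Import Order.TTheory GRing.Theory Num.Theory.

Local Open Scope classical_set_scope.
Local Open Scope ring_scope.

(* The subset A of X, with the metric induced by X, is an SRA(alpha) space;
   for A = setT this says that X itself is one. *)
Definition isSRA (R : realType) (alpha : R) (X : metricType R) (A : set X) :
    Prop :=
  forall x y z : X, A x -> A y -> A z ->
    mdist x y <= Num.max (mdist x z + alpha * mdist z y)
                         (alpha * mdist x z + mdist z y).

(* The points x_1, ..., x_(n+1) of the space are x ord0, ..., x ord_max, so a
   family indexed by 'I_n.+1 enumerates a space with n + 1 >= 1 points;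
   bijectivity says that these points are distinct and exhaust X. *)
Definition isDSE (R : realType) (X : metricType R) (n : nat)
    (x : 'I_n.+1 -> X) : Prop :=
  bijective x /\
  forall i j k : 'I_n.+1, (i <= j)%N -> (j <= k)%N ->
    mdist (x i) (x j) <= mdist (x i) (x k).

Definition DSE_length (R : realType) (X : metricType R) (n : nat)
    (x : 'I_n.+1 -> X) : R :=
  \sum_(i < n) mdist (x (widen_ord (leqnSn n) i)) (x (lift ord0 i)).

(* This is 0 for a one-point space (n = 0), in which case
   DSE_length x / DSE_diam x is 0 / 0 = 0; otherwise it is positive when x is
   injective. *)
Definition DSE_diam (R : realType) (X : metricType R) (n : nat)
    (x : 'I_n.+1 -> X) : R :=
  mdist (x ord0) (x ord_max).

(* Main.v *)
Require Import Defs.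
From HB Require Import structures.
From mathcomp Require Import all_boot all_order all_algebra.
From mathcomp Require Import all_classical all_reals.
From mathcomp Require Import topology.
From mathcomp Require Import zify lra.

Set Implicit Arguments.
Unset Strict Implicit.
Unset Printing Implicit Defensive.

Import Order.TTheory GRing.Theory Num.Theory.

Local Open Scope classical_set_scope.
Local Open Scope ring_scope.

(* Put eta = alpha/2 and suppose that there is no k-point SRA(alpha) subset.
   By Ramsey's theorem, boundedly many points have their pairwise distances in
   a given range [w, B w].  Call a point b of an interval [a, v] loud if a long
   piece [b, c], with len [b, c] > M d(b, c), starts at b at the small scale
   d(b, c) <= eta d(a, b).  Up to the first loud point b, the length from a is
   O(d(a, b)), since each dyadic annulus around a contains O(1) steps that are
   large relative to their distance to a.  Let F be the sum of the distances to
   finitely many points chosen before; F is nondecreasing and its variation is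
   O(d(u, v)).  If [u, v] is long enough, then a greedy decomposition into such
   blocks shows that for one of them F(b) - F(a) < eta d(a, b).  Choose a, and
   go on inside the piece [b, c], which is long and tiny compared with d(a, b):
   seen from each point q chosen before a, every later point lies at distance
   d(q, a) up to 2 eta d(a, b) <= alpha d(a, b), so the k chosen points form an
   SRA(alpha) space. *)

(** * Ramsey's theorem for ordered pairs in a sequence *)

Lemma sum_count_color (T : Type) (c : nat) (col : T -> 'I_c) (s : seq T) :
  (\sum_(i < c) count (fun y => col y == i) s)%N = size s.
Proof.
elim: s => [|x s IHs] /=; first by rewrite big1.
rewrite big_split /= IHs (bigD1 (col x)) //= eqxx big1 // => i.
by rewrite eq_sym => /negPf ->.
Qed.

(** Induction on the sum of the targets [t i]. The head [x] has some colour [i] with at least [N i]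
    later points; among these, the target of [i] is lowered by one. A sequence found in colour [i]
    is completed by [x]; one in another colour already has full size. *)
Lemma ramsey_pairs (T : eqType) (c : nat) (t : 'I_c.+1 -> nat) :
  exists N : nat, forall (col : T -> T -> 'I_c.+1) (s : seq T),
    (N <= size s)%N ->
    exists i s', [/\ subseq s' s, size s' = t i &
                     pairwise (fun x y => col x y == i) s'].
Proof.
have [m] := ubnP (\sum_i t i)%N; elim: m => // m IHm in t *; rewrite ltnS => tm.
have [[i ti0]|tpos] := pselect (exists i, t i = 0%N).
  by exists 0%N => col s _; exists i, [::]; rewrite sub0seq ti0.
have {}tpos i : (0 < t i)%N by rewrite lt0n; apply/eqP => ti0; apply: tpos; exists i.
pose t' i j := if j == i then (t j).-1 else t j.
have /choice[N NP] : forall i, exists N, forall (col : T -> T -> 'I_c.+1) s,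
    (N <= size s)%N -> exists j s', [/\ subseq s' s, size s' = t' i j &
                     pairwise (fun x y => col x y == j) s'].
  move=> i; apply: IHm; apply: leq_trans tm.
  rewrite [leqRHS](bigD1 i) //= (bigD1 i) //= {1}/t' eqxx -addSn prednK // leq_add2l.
  by apply: leq_sum => j /negPf; rewrite /t' => ->.
exists (\sum_i N i).+1 => col [//|x s] /=; rewrite ltnS => Ns.
have [i Ni] : exists i, (N i <= count (fun y => col x y == i) s)%N.
  apply: contrapT => noi; move: Ns; rewrite -(sum_count_color (col x) s) leqNgt.
  have lt_i i : (count (fun y => col x y == i) s < N i)%N.
    by rewrite ltnNge; apply/negP => Ni; apply: noi; exists i.
  rewrite (bigD1 ord0) //= [X in (_ < X)%N](bigD1 ord0) //= -addSn.
  by rewrite leq_add // leq_sum // => i _; apply: ltnW.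
have [|j [s' [s's szs' ps']]] := NP i col [seq y <- s | col x y == i].
  by rewrite size_filter.
have s'_s : subseq s' s := subseq_trans s's (filter_subseq _ _).
move: szs'; rewrite /t'; case: eqP => [ji|_] szs'; last first.
  by exists j, s'; split=> //; apply: subseq_trans s'_s (subseq_cons _ _).
exists j, (x :: s'); split; first by rewrite /= eqxx.
  by rewrite /= szs' prednK.
rewrite pairwise_cons ps' andbT ji; apply/allP => y /(mem_subseq s's).
by rewrite mem_filter => /andP[].
Qed.

(** * Self-expanding distances on indices, and narrow sets *)

Record self_expanding (R : realType) (n : nat) (d : nat -> nat -> R) : Prop := {
  sx_refl : forall i, d i i = 0;
  sx_sym : forall i j, d i j = d j i;
  sx_tri : forall i j l, d i l <= d i j + d j l;
  sx_mono : forall i j l, (i <= j)%N -> (j <= l)%N -> d i j <= d i l;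
  sx_pos : forall i j, (i < j)%N -> (j <= n)%N -> 0 < d i j }.

(* The instances of the SRA(alpha) inequality that monotonicity does not give. *)
Definition narrow (R : realType) (alpha : R) (d : nat -> nat -> R)
    (s : seq nat) : Prop :=
  forall i j l, i \in s -> j \in s -> l \in s -> (i < j)%N -> (j < l)%N ->
    d i l <= d i j + alpha * d j l /\ d j l <= d i l + alpha * d i j.

Definition increasing_upto (n : nat) (s : seq nat) :=
  sorted ltn s && all (leq^~ n) s.

Definition narrow_free (R : realType) (alpha : R) (k n : nat)
    (d : nat -> nat -> R) : Prop :=
  forall s, size s = k -> increasing_upto n s -> ~ narrow alpha d s.

Lemma sx_ge0 (R : realType) (n : nat) (d : nat -> nat -> R) i j :
  self_expanding n d -> 0 <= d i j.
Proof.
by move=> dP; have := sx_tri dP i j i; rewrite (sx_refl dP) (sx_sym dP j i); lra.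
Qed.

(** By symmetry [x] comes before [y]. The first narrow inequality serves [z] between them, the
    second one [z] before [x], and monotonicity [z] after [y]. *)
Lemma narrow_SRA (R : realType) (alpha : R) (n : nat) (d : nat -> nat -> R)
    (s : seq nat) x y z :
  0 < alpha -> self_expanding n d -> narrow alpha d s ->
  x \in s -> y \in s -> z \in s ->
  d x y <= Num.max (d x z + alpha * d z y) (alpha * d x z + d z y).
Proof.
move=> a0 dP ds; have d0 i j := sx_ge0 i j dP.
wlog xy : x y / (x <= y)%N => [hw xs ys zs|xs ys zs].
  have [xy|/ltnW yx] := leqP x y; first exact: hw.
  rewrite maxC addrC [X in Num.max _ X]addrC (sx_sym dP x y).
  by rewrite (sx_sym dP x z) (sx_sym dP z y); apply: hw.
rewrite le_max; have aM i j : 0 <= alpha * d i j by rewrite mulr_ge0 // ltW.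
have [->|nxy] := eqVneq x y; first by rewrite (sx_refl dP) addr_ge0.
have {nxy}xy : (x < y)%N by rewrite ltn_neqAle nxy.
have [zx|xz|->] := ltngtP z x.
- have [_ ] := ds z x y zs xs ys zx xy.
  by rewrite (sx_sym dP z x) addrC => ->; rewrite orbT.
- have [zy|yz|->] := ltngtP z y.
  + by have [-> _] := ds x z y xs zs ys xz zy.
  + have := sx_mono dP (ltnW xy) (ltnW yz); have := aM z y.
    by move=> h1 h2; apply/orP; left; lra.
  + by rewrite (sx_refl dP) mulr0 addr0 lexx.
- by apply/orP; right; rewrite (sx_refl dP) mulr0 add0r.
Qed.

(** Colour a pair by the integer part of its distance divided by [alpha * w]; distances up to
    [B * w] need boundedly many colours. In a monochromatic set any two distances differ by at most
    [alpha * w], hence by at most [alpha] times any third distance, so the set is narrow. *)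
Lemma narrow_free_doubling (R : realType) (alpha B : R) (k : nat) :
  0 < alpha -> 0 <= B ->
  exists N : nat, forall (n : nat) (d : nat -> nat -> R), self_expanding n d ->
    narrow_free alpha k n d ->
    forall (w : R) (s : seq nat), 0 < w -> increasing_upto n s ->
      pairwise (fun i j => w <= d i j <= B * w) s -> (size s < N)%N.
Proof.
move=> a0 B0; pose c := Num.truncn (B / alpha).
have [N NP] := @ramsey_pairs nat c (fun=> k).
exists N => n d dP free w s w0 /andP[ltns lens] sep; rewrite ltnNge; apply/negP => Ns.
have aw0 : 0 < alpha * w by rewrite mulr_gt0.
pose q i j := d i j / (alpha * w).
have q0 i j : 0 <= q i j by rewrite divr_ge0 ?(sx_ge0 _ _ dP) // ltW.
have [g [s' [s's szs' cols']]] := NP (fun i j => inord (Num.truncn (q i j))) s Ns.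
apply: (free s' szs'); first rewrite /increasing_upto.
  rewrite (subseq_sorted ltn_trans s's ltns) /=.
  by apply/allP => i /(mem_subseq s's); apply: (allP lens).
have {}sep := subseq_pairwise s's sep.
have {}ltns := subseq_sorted ltn_trans s's ltns.
have pair (r : rel nat) i j : pairwise r s' -> i \in s' -> j \in s' -> (i < j)%N -> r i j.
  move=> /(pairwiseP 0%N) rs is' js' ij.
  rewrite -(nth_index 0%N is') -(nth_index 0%N js'); apply: rs; rewrite ?inE ?index_mem //.
  rewrite ltnNge leq_eqVlt; apply/negP => /orP[/eqP e|lt_ji].
    by move: ij; rewrite -(nth_index 0%N is') -e nth_index // ltnn.
  have := ltns; rewrite (sorted_pairwise ltn_trans) => /(pairwiseP 0%N).
  move=> /(_ (index j s') (index i s')); rewrite !inE !index_mem => /(_ js' is' lt_ji) /=.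
  by rewrite !nth_index // ltnNge (ltnW ij).
have close i j i' j' : i \in s' -> j \in s' -> i' \in s' -> j' \in s' ->
    (i < j)%N -> (i' < j')%N -> d i j <= d i' j' + alpha * w.
  move=> is' js' i's' j's' ij i'j'.
  have cs p r : p \in s' -> r \in s' -> (p < r)%N -> Num.truncn (q p r) = g.
    move=> ps rs pr; rewrite -(eqP (pair _ _ _ cols' ps rs pr)) inordK // ltnS.
    have /andP[_ ub] := pair _ _ _ sep ps rs pr.
    apply: le_truncn; rewrite /q ler_pdivrMr // mulrA divfK ?gt_eqF //.
  have /andP[_] := truncn_itv (q0 i j); rewrite (cs i j) //.
  have /andP[+ _] := truncn_itv (q0 i' j'); rewrite (cs i' j') //.
  rewrite /q ler_pdivlMr // ltr_pdivrMr // -natr1 mulrDl mul1r => h1 h2.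
  by rewrite ltW // (lt_le_trans h2) // lerD2r.
move=> i j l is' js' ls' ij jl; have il := ltn_trans ij jl.
have /andP[w1 _] := pair _ _ _ sep is' js' ij.
have /andP[w2 _] := pair _ _ _ sep js' ls' jl.
split; [apply: (le_trans (close i l i j _ _ _ _ _ _)) | apply: (le_trans (close j l i l _ _ _ _ _ _))] => //.
all: by rewrite lerD2l ler_pM2l.
Qed.

(* lia after discarding the hypotheses on real numbers, whose preprocessing is
   very slow. *)
Ltac nat_lia :=
  repeat match goal with
  | H : ?P |- _ =>
    lazymatch type of P with
    | Prop =>
      lazymatch P with
      | is_true (leq _ _) => fail
      | is_true (leq _ _ && leq _ _) => fail
      | is_true (~~ (@eq_op _ _ _)) => fail
      | @eq nat _ _ => fail
      | _ => clear H
      end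
    end
  end; lia.

(** * Length of intervals without loud points *)

Definition len (R : realType) (d : nat -> nat -> R) (u v : nat) : R :=
  \sum_(u <= i < v) d i i.+1.

Lemma lenxx (R : realType) (d : nat -> nat -> R) u : len d u u = 0.
Proof. by rewrite /len big_geq. Qed.

Lemma len_cat (R : realType) (d : nat -> nat -> R) y u v :
  (u <= y)%N -> (y <= v)%N -> len d u v = len d u y + len d y v.
Proof. by move=> uy yv; rewrite /len (big_cat_nat uy yv). Qed.

Lemma len_jump (R : realType) (d : nat -> nat -> R) u v :
  (u <= v)%N -> len d u v.+1 = len d u v + d v v.+1.
Proof. by move=> uv; rewrite /len big_nat_recr. Qed.

(** No point strictly between [a] and [b] is loud, for pieces ending at or before [b]. *)
Definition quiet (R : realType) (eta M : R) (d : nat -> nat -> R) (a b : nat) :=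
  forall j c, (a < j)%N -> (j < c)%N -> (c <= b)%N ->
    d j c <= eta * d a j -> len d j c <= M * d j c.

(** Starting at [y], wait until the distance to [y] exceeds [eta * rho / 2], and restart there. By
    monotonicity all later points stay that far from [y]. Each round uses at most [sg] of length, so
    a length above [m%:R * sg] allows [m] rounds. *)
Lemma quiet_annulus (R : realType) (eta M : R) (n : nat) (d : nat -> nat -> R)
    (a b : nat) (rho sg : R) :
  self_expanding n d -> 0 < eta -> 0 <= M -> quiet eta M d a b ->
  0 < rho -> d a b <= rho -> M * (eta * rho / 2) + 2 * rho <= sg ->
  forall m y, (a < y)%N -> (y <= b)%N -> rho <= 2 * d a y ->
  m%:R * sg < len d y b ->
  exists s, [/\ size s = m.+1, sorted ltn s,
    all (fun i => y <= i <= b)%N s &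
    pairwise (fun i j => eta * rho / 2 <= d i j <= 2 * rho) s].
Proof.
move=> dP eta0 M0 qt rho0 abr; set w := eta * rho / 2 => sgE.
have w0 : 0 <= w by rewrite ltW // divr_gt0 // mulr_gt0.
have M1 : 0 <= M * w by rewrite mulr_ge0.
elim=> [|m IHm] y ay yb ry leny; first by exists [:: y]; rewrite /= leqnn yb.
have mK0 : 0 <= m%:R * sg by rewrite mulr_ge0 //; lra.
have {}leny : m%:R * sg + sg < len d y b.
  by move: leny; rewrite -natr1 mulrDl mul1r.
have short y' : (y <= y')%N -> (y' <= b)%N -> d y y' <= w -> len d y y' <= M * w.
  move=> yy' y'b dyy'; have [<-|nyy'] := eqVneq y y'; first by rewrite lenxx.
  apply: le_trans (ler_wpM2l M0 dyy'); apply: qt => //; first by nat_lia.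
  apply: le_trans dyy' _; rewrite /w -mulrA ler_pM2l // ler_pdivrMr //.
  by rewrite mulrC.
have exc : exists c, [&& (y < c)%N, (c <= b)%N & w < d y c].
  apply: contrapT => noc; suff : len d y b <= M * w by clear -leny mK0 sgE rho0; lra.
  apply: short => //; rewrite leNgt; apply/negP => h; apply: noc; exists b.
  rewrite h leqnn !andbT ltn_neqAle yb andbT; apply/eqP => e.
  by move: h; rewrite e (sx_refl dP) ltNge w0.
(* The first exit is [c.+1]. Up to [c] quietness bounds the length by [M * w]; the exit jump is
   bounded only by the diameter [2 * rho]. *)
case: (ex_minnP exc) => -[|c] /and3P[yc cb sep] minc //.
have yc' : (y <= c)%N by nat_lia.
have lenc : len d y c <= M * w.
  apply: short => //; first nat_lia.
  have [<-|nyc] := eqVneq y c; first by rewrite (sx_refl dP).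
  rewrite leNgt; apply/negP => h.
  have /minc : [&& (y < c)%N, (c <= b)%N & w < d y c] by rewrite h andbT; nat_lia.
  by rewrite ltnn.
have da i : (a <= i)%N -> (i <= b)%N -> d a i <= rho.
  by move=> ai ib; apply: le_trans abr; apply: (sx_mono dP).
have diam i j : (a <= i)%N -> (i <= b)%N -> (a <= j)%N -> (j <= b)%N -> d i j <= 2 * rho.
  move=> ai ib aj jb; apply: le_trans (sx_tri dP i a j) _.
  by rewrite (sx_sym dP i a) mulr2n mulrDl mul1r lerD // da.
have step : d c c.+1 <= 2 * rho by apply: diam; nat_lia.
have lens : m%:R * sg < len d c.+1 b.
  move: leny; rewrite (@len_cat _ d c.+1 y b) //; last nat_lia.
  by rewrite len_jump // => leny; clear -leny lenc step sgE; lra.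
have acd : rho <= 2 * d a c.+1.
  by apply: le_trans ry _; rewrite ler_pM2l // (sx_mono dP) // ltnW.
have [s [szs ss ins ps]] := IHm c.+1 (ltn_trans ay yc) cb acd lens.
exists (y :: s); split.
- by rewrite /= szs.
- rewrite /= path_min_sorted //.
  by apply/allP => i /(allP ins) /=; nat_lia.
- rewrite /= leqnn yb /=; apply/allP => i /(allP ins) /=; nat_lia.
- rewrite pairwise_cons ps andbT; apply/allP => i /(allP ins) /andP[ci ib].
  rewrite diam ?andbT //; try nat_lia.
  exact: le_trans (ltW sep) (sx_mono dP (ltnW yc) ci).
Qed.

(** Strong induction on [b]. The points within half of [rho = d a b] contribute [C * rho / 2] by
    induction, the jump out of them at most [2 * rho], and the remaining annulus less than [N]
    rounds' worth of length; [C] solves the resulting linear equation. The ratio [4 / eta] is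
    [2 * rho] over [eta * rho / 2]. *)
Lemma quiet_len (R : realType) (eta M : R) (n N : nat) (d : nat -> nat -> R)
    (a b : nat) :
  self_expanding n d -> 0 < eta -> 0 <= M ->
  (forall (w : R) (s : seq nat), 0 < w -> increasing_upto n s ->
      pairwise (fun i j => w <= d i j <= 4 / eta * w) s -> (size s < N)%N) ->
  (a <= b)%N -> (b <= n)%N -> quiet eta M d a b ->
  len d a b <= (4 + N%:R * (M * eta + 4)) * d a b.
Proof.
move=> dP eta0 M0 dbl; set C := (4 + _).
elim/ltn_ind: b => b IHb ab bn qt.
have K0 : 0 <= N%:R * (M * eta + 4) by rewrite mulr_ge0 // addr_ge0 // mulr_ge0 // ltW.
have C0 : 0 <= C by rewrite addr_ge0.
have [<-|nab] := eqVneq a b; first by rewrite lenxx mulr_ge0 // (sx_ge0 _ _ dP).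
have {nab} ab' : (a < b)%N by nat_lia.
have rho0 := sx_pos dP ab' bn; set rho := d a b in rho0 *.
have exy : exists y, [&& (a < y)%N, (y <= b)%N & rho <= 2 * d a y].
  by exists b; rewrite ab' leqnn /= -/rho; clear -rho0; lra.
case: (ex_minnP exy) => -[|y] /and3P[ay yb ry] miny //.
have ay' : (a <= y)%N by nat_lia.
have dy : d a y <= rho / 2.
  have [->|nay] := eqVneq a y; first by rewrite (sx_refl dP) divr_ge0 // ltW.
  rewrite ler_pdivlMr // mulrC leNgt; apply/negP => h.
  have /miny : [&& (a < y)%N, (y <= b)%N & rho <= 2 * d a y] by rewrite (ltW h) andbT; nat_lia.
  by rewrite ltnn.
have h1 : len d a y <= C * rho / 2.
  rewrite -mulrA; apply: le_trans (ler_wpM2l C0 dy).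
  by apply: IHb => //; [nat_lia | move=> j c aj jc cy; apply: qt => //; nat_lia].
have h3 : d y y.+1 <= 2 * rho.
  have := sx_tri dP y a y.+1; rewrite (sx_sym dP y a).
  have := sx_mono dP (ltnW ay) yb; rewrite -/rho => u1 u2; clear -u1 u2 dy rho0; lra.
have h4 : len d y.+1 b <= N%:R * (M * (eta * rho / 2) + 2 * rho).
  rewrite leNgt; apply/negP => h.
  have [s [szs ss ins ps]] := quiet_annulus dP eta0 M0 qt rho0 (lexx _) (lexx _) ay yb ry h.
  suff : (size s < N)%N by nat_lia.
  apply: (dbl (eta * rho / 2)); first by rewrite divr_gt0 // mulr_gt0.
    by rewrite /increasing_upto ss; apply/allP => i /(allP ins) /=; nat_lia.
  suff -> : 4 / eta * (eta * rho / 2) = 2 * rho by [].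
  by rewrite mulrA mulrA divfK ?gt_eqF //; lra.
rewrite (@len_cat _ d y.+1 a b) // ?len_jump //; last nat_lia.
have eC : C * rho = C * rho / 2 + 2 * rho + N%:R * (M * (eta * rho / 2) + 2 * rho).
  by rewrite /C; clear; lra.
by rewrite eC !lerD.
Qed.

(* Cutting [u, v] greedily at the first non-quiet point: each block is short
   relative to its chord, and its chord is paid for by an increment of F. *)
Lemma len_le_variation (R : realType) (eta M C : R) (d : nat -> nat -> R) (n u v : nat)
    (F : nat -> R) :
  self_expanding n d -> 0 < eta -> 0 <= C -> (u <= v)%N -> (v <= n)%N ->
  (forall a b, (u <= a)%N -> (a <= b)%N -> (b <= v)%N -> quiet eta M d a b ->
     len d a b <= C * d a b) ->
  (forall a b, (u <= a)%N -> (a <= b)%N -> F a <= F b) ->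
  (forall a b c, (u <= a)%N -> (a < b)%N -> (b < c)%N -> (c <= v)%N ->
     d b c <= eta * d a b -> M * d b c < len d b c ->
     eta * d a b <= F b - F a) ->
  len d u v <= C / eta * (F v - F u) + 2 * C * d u v.
Proof.
move=> dP eta0 C0 uv vn qlen Fmono gain.
suff main m a : (v - a <= m)%N -> (u <= a)%N -> (a <= v)%N ->
    len d a v <= C / eta * (F v - F a) + 2 * C * d u v.
  exact: main (leqnn _) (leqnn u) uv.
have Ce0 : 0 <= C / eta by rewrite divr_ge0 // ltW.
elim: m a => [|m IHm] a vam ua av.
  have -> : a = v by nat_lia.
  by rewrite lenxx subrr mulr0 add0r mulr_ge0 ?(sx_ge0 _ _ dP) // mulr_ge0.
pose loud b := `[< exists c, [/\ (b < c)%N, (c <= v)%N, d b c <= eta * d a b &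
                                  M * d b c < len d b c] >].
have [exb|nob] := pselect (exists b, [&& (a < b)%N, (b <= v)%N & loud b]); last first.
  (* The last block does not end at a loud point, so [F] does not pay for it. Its chord is at most
     [2 * d u v], whence the additive term. *)
  have qav : quiet eta M d a v.
    move=> j c aj jc cv djc; rewrite leNgt; apply/negP => h; apply: nob.
    by exists j; rewrite aj /=; apply/andP; split; [nat_lia|apply/asboolP; exists c].
  have h0 := qlen a v ua av (leqnn v) qav.
  have h1 : d a v <= 2 * d u v.
    have := sx_tri dP a u v; rewrite (sx_sym dP a u).
    by have := sx_mono dP ua av; lra.
  have h2 : C * d a v <= C * (2 * d u v) by rewrite ler_wpM2l.
  have h3 : 0 <= C / eta * (F v - F a) by rewrite mulr_ge0 // subr_ge0 Fmono.
  apply: le_trans h0 (le_trans h2 _).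
  by rewrite mulrA [C * 2]mulrC lerDr.
case: (ex_minnP exb) => b /and3P[ab bv /asboolP[c [bc cv dbc Mlen]]] minb.
have qab : quiet eta M d a b.
  move=> j c' aj jc' c'b djc'; rewrite leNgt; apply/negP => h.
  have /minb : [&& (a < j)%N, (j <= v)%N & loud j].
    rewrite aj /=; apply/andP; split; [nat_lia|apply/asboolP; exists c'; split=> //; nat_lia].
  by nat_lia.
have h1 := qlen a b ua (ltnW ab) bv qab.
have h2 := gain a b c ua ab bc cv dbc Mlen.
have h3 : C * d a b <= C / eta * (F b - F a).
  have -> : C * d a b = C / eta * (eta * d a b) by rewrite mulrA divfK // gt_eqF.
  by rewrite ler_wpM2l.
have h4 : len d b v <= C / eta * (F v - F b) + 2 * C * d u v by apply: IHm; nat_lia.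
rewrite (@len_cat _ d b a v) ?(ltnW ab) //.
have -> : F v - F a = (F b - F a) + (F v - F b) by lra.
by rewrite mulrDr -addrA lerD // (le_trans h1).
Qed.

(** * Recursive extraction of a narrow set *)

(** [Q] holds the points chosen before; the inequality from [Q] to [Z] is what keeps the set narrow
    when those points are put back. As [size Q] is at most [k], the threshold [M] is independent of
    [Q]. *)
Lemma narrow_extraction (R : realType) (alpha : R) (k : nat) :
  0 < alpha < 1 ->
  forall m, exists2 M : R, 0 <= M & forall (n : nat) (d : nat -> nat -> R),
    self_expanding n d -> narrow_free alpha k n d ->
    forall (Q : seq nat) (u v : nat), (size Q + m <= k)%N ->
      all (leq^~ u) Q -> (u <= v)%N -> (v <= n)%N -> M * d u v < len d u v ->
      exists Z, [/\ size Z = m, sorted ltn Z, all (fun i => u <= i <= v)%N Z,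
        narrow alpha d Z &
        forall q i j, q \in Q -> i \in Z -> j \in Z -> (i < j)%N ->
          d q j <= d q i + alpha * d i j].
Proof.
move=> /andP[a0 a1]; pose eta := alpha / 2.
have eta0 : 0 < eta by rewrite divr_gt0.
have [|N dbl] := @narrow_free_doubling R alpha (4 / eta) k a0.
  by rewrite divr_ge0 // ltW.
elim=> [|m [M M0 IHm]].
  by exists 0 => // n d dP free Q u v _ _ _ _ _; exists [::]; split.
pose C := 4 + N%:R * (M * eta + 4).
have C0 : 0 <= C by rewrite addr_ge0 // mulr_ge0 // addr_ge0 // mulr_ge0 // ltW.
have Ce0 : 0 <= C / eta by rewrite divr_ge0 // ltW.
(* [F] varies by at most [k%:R * d u v] on [u, v]; this is the resulting bound in
   [len_le_variation]. Here [C] is built from the threshold for [m] points. *)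
exists (C / eta * k%:R + 2 * C); first by rewrite addr_ge0 // mulr_ge0.
move=> n d dP free Q u v szQ Qu uv vn long; have d0 i j := sx_ge0 i j dP.
pose F i := \sum_(q <- Q) d q i.
have Qmono q a b : q \in Q -> (u <= a)%N -> (a <= b)%N -> d q a <= d q b.
  by move=> /(allP Qu) qu ua ab; apply: (sx_mono dP) ab; apply: leq_trans ua.
have [a [b [c [/andP[ua ab] /andP[bc cv] dbc Mlen flat]]]] : exists a b c,
    [/\ (u <= a < b)%N, (b < c <= v)%N, d b c <= eta * d a b,
        M * d b c < len d b c & F b - F a < eta * d a b].
  apply: contrapT => noabc; suff : len d u v <= (C / eta * k%:R + 2 * C) * d u v.
    by rewrite leNgt long.
  apply: le_trans (_ : _ <= C / eta * (F v - F u) + 2 * C * d u v) _.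
    apply: (len_le_variation (n := n) (M := M)) => //.
    - move=> a b ua ab bv; apply: (quiet_len (n := n)) => //; last exact: leq_trans vn.
      by move=> w s; apply: dbl.
    - move=> a b ua ab; rewrite /F big_seq [leRHS]big_seq; apply: ler_sum => q qQ.
      exact: Qmono.
    - move=> a b c ua ab bc cv dbc Mlen; rewrite leNgt; apply/negP => flat.
      by apply: noabc; exists a, b, c; rewrite ua ab bc.
  rewrite [leRHS]mulrDl lerD2r -[leRHS]mulrA ler_wpM2l // /F -sumrB.
  apply: le_trans (_ : _ <= \sum_(q <- Q) d u v) _.
    by apply: ler_sum => q _; have := sx_tri dP q u v; rewrite lerBlDl.
  rewrite big_const_seq count_predT iter_addr_0 -[_ *+ size Q]mulr_natl ler_wpM2r // ler_nat.
  by apply: leq_trans szQ; apply: leq_addr.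
have dab : d a b <= d a c by apply: (sx_mono dP); apply: ltnW.
(* All summands of [F] are nondecreasing from [u] on, so each increment is at most the total one. *)
have Qflat q : q \in Q -> d q b <= d q a + eta * d a b.
  move=> qQ; rewrite -lerBlDl; apply: le_trans (ltW flat); rewrite /F -sumrB.
  rewrite (big_rem q) //= lerDl big_seq sumr_ge0 // => p /mem_rem pQ.
  by rewrite subr_ge0 Qmono // ltnW.
have [|||||Z [szZ sZ inZ nZ QZ]] := IHm n d dP free (a :: Q) b c => //.
- by rewrite /= addSnnS.
- rewrite /= (ltnW ab); apply/allP => q /(allP Qu) /= qu; nat_lia.
- exact: ltnW.
- exact: leq_trans vn.
have Zb i : i \in Z -> (b <= i)%N by move=> /(allP inZ) /andP[].
have near i : i \in Z -> d b i <= eta * d a b.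
  move=> iZ; apply: le_trans dbc; have /andP[bi ic] := allP inZ i iZ.
  exact: (sx_mono dP).
have far i : i \in Z -> d a b <= d a i.
  by move=> iZ; apply: (sx_mono dP); [exact: ltnW | exact: Zb].
have halves x : eta * x + eta * x = alpha * x by rewrite /eta; lra.
exists (a :: Z); split.
- by rewrite /= szZ.
- rewrite /= path_min_sorted //; apply/allP => i iZ /=.
  exact: leq_trans ab (Zb i iZ).
- apply/allP => i; rewrite inE => /predU1P[->|/(allP inZ) /=]; nat_lia.
- move=> i j l; rewrite !inE => /predU1P[->|iZ] /predU1P[->|jZ] /predU1P[->|lZ] ij jl.
  all: try by [move: ij jl; rewrite ?ltnn | have := Zb _ iZ; nat_lia
              | have := Zb _ jZ; nat_lia].
  (* The first inequality is the one from [a], now a member of the enlarged [Q]. For the second,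
     [d j l] is at most [2 * eta * d a b], which is below [d a l]. *)
  + split; first by apply: QZ => //; rewrite mem_head.
    rewrite ler_wpDr ?mulr_ge0 ?(ltW a0) //; apply: le_trans (sx_tri dP j b l) _.
    rewrite (sx_sym dP j b); apply: le_trans (lerD (near _ jZ) (near _ lZ)) _.
    rewrite halves; apply: le_trans (far _ lZ).
    by rewrite ler_piMl // ltW.
  + exact: nZ.
- move=> q i j qQ; rewrite !inE => /predU1P[->|iZ] /predU1P[->|jZ] ij.
  + by rewrite ltnn in ij.
  (* Two errors [eta * d a b] add up, one from the flatness of [F] and one from the smallness of
     [b, c]; hence [eta = alpha / 2]. *)
  + apply: le_trans (sx_tri dP q b j) _.
    apply: le_trans (lerD (Qflat _ qQ) (near _ jZ)) _.
    by rewrite -addrA lerD2l halves ler_pM2l // far.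
  + by have := Zb _ iZ; nat_lia.
  + by apply: QZ; rewrite // inE qQ orbT.
Qed.

(* Clamping the indices at n makes all the axioms but positivity hold on the
   whole of nat. *)
Lemma DSE_self_expanding (R : realType) (X : metricType R) (n : nat)
    (x : 'I_n.+1 -> X) :
  isDSE x ->
  self_expanding n (fun i j => mdist (x (inord (minn i n))) (x (inord (minn j n)))).
Proof.
move=> [/bij_inj xinj xmono]; split.
- by move=> i; rewrite mdistxx.
- by move=> i j; rewrite metric_sym.
- by move=> i j l; apply: metric_triangle.
- move=> i j l ij jl; apply: xmono; rewrite !inordK ?ltnS ?geq_minr //.
    by rewrite leq_min geq_minr andbT (leq_trans (geq_minl _ _)).
  by rewrite leq_min geq_minr andbT (leq_trans (geq_minl _ _)).
- move=> i j ij jn; rewrite mdist_gt0; apply/eqP => /xinj /(congr1 val) /=.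
  rewrite !inordK ?ltnS ?geq_minr // (minn_idPl jn) (minn_idPl (leq_trans (ltnW ij) jn)).
  by move=> e; rewrite e ltnn in ij.
Qed.

(** * Return to metric spaces *)

Theorem theorem2 (R : realType) (alpha : R) (halpha : 2^-1 < alpha < 1)
    (k : nat) :
  exists C : R, 0 < C /\
    forall (X : metricType R) (n : nat) (x : 'I_n.+1 -> X),
      isDSE x -> C < DSE_length x / DSE_diam x ->
      exists Y : set X, (Y #= `I_k)%card /\ isSRA alpha Y.
Proof.
have a01 : 0 < alpha < 1.
  by move/andP: halpha => [h ->]; rewrite andbT (lt_trans _ h) // invr_gt0.
have /andP[a0 _] := a01.
have [M M0 extract] := narrow_extraction k a01 k.
exists (M + 1); split; first by rewrite ltr_wpDl.
move=> X n x xDSE long; have xinj := bij_inj xDSE.1.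
have dP := DSE_self_expanding xDSE; set d := fun i j => _ in dP.
have len_d : len d 0 n = DSE_length x.
  rewrite /len big_mkord; apply: eq_bigr => i _; rewrite /d.
  have iE : inord (minn i n) = widen_ord (leqnSn n) i.
    by apply/val_inj; rewrite /= inordK ?ltnS ?geq_minr //; apply/minn_idPl/ltnW.
  have iSE : inord (minn i.+1 n) = lift ord0 i.
    by apply/val_inj; rewrite /= inordK ?ltnS ?geq_minr //; apply/minn_idPl.
  by rewrite iE iSE.
have diam_d : d 0%N n = DSE_diam x.
  rewrite /d /DSE_diam min0n minnn; congr (mdist (x _) (x _)); apply/val_inj.
    by rewrite /= inordK.
  by rewrite /= inordK.
have M10 : 0 < M + 1 by rewrite ltr_wpDl.
(* Division by zero yields 0, which is not above the positive constant; this excludes the one-point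
   space. *)
have diam0 : 0 < DSE_diam x.
  rewrite lt_neqAle mdist_ge0 andbT eq_sym; apply/eqP => D0.
  by move: long; rewrite D0 invr0 mulr0 ltNge ltW.
have long_d : M * d 0%N n < len d 0 n.
  rewrite len_d diam_d -ltr_pdivlMr //; apply: lt_trans long.
  by rewrite ltrDl.
(* If no such set existed, [narrow_free] would hold and the extraction from [0, n] with empty [Q]
   would produce one. *)
have [s [szs incs ns]] : exists s, [/\ size s = k, increasing_upto n s & narrow alpha d s].
  apply: contrapT => nos.
  have free : narrow_free alpha k n d.
    by move=> s szs incs ns; apply: nos; exists s.
  have [s [szs sorts ins ns _]] :=
    extract n d dP free [::] 0%N n (leqnn k) isT (leq0n n) (leqnn n) long_d.
  by apply: nos; exists s; split; rewrite // /increasing_upto sorts.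
move: incs => /andP[sorts ins].
have sn i : (i < k)%N -> (nth 0%N s i <= n)%N.
  by move=> ik; apply: (allP ins); rewrite mem_nth // szs.
exists [set x (inord (minn (nth 0%N s i) n)) | i in `I_k]; split.
  apply: inj_card_eq => i j; rewrite !inE /= => ik jk /xinj /(congr1 val) /=.
  rewrite !inordK ?ltnS ?geq_minr // (minn_idPl (sn i ik)) (minn_idPl (sn j jk)).
  move/eqP; rewrite nth_uniq ?szs //; first by move/eqP.
  exact: (sorted_uniq ltn_trans ltnn).
move=> _ _ _ [i /= ik <-] [j /= jk <-] [l /= lk <-].
by apply: (narrow_SRA a0 dP ns); rewrite mem_nth // szs.
Qed.
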